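(* Suppose that either (i) $1<m<n$ and $0<\alpha\leq 1$, or (ii) $-1<m<n$ and $\alpha=0$. Then there exist positive constants $C$, $C'$ and $N_0$ (depending on $m,n,\alpha$ but not on $N$; the values of $C,C'$ may differ from one inequality to another) such that, for any $N>N_0$ and any minimizer $X_N$ of the energy functional $E$ over $\{y_1<\cdots<y_N\}$, the following hold. (A) (energy scaling law) In case (i), $-CN\leq E_N\leq -C'N$; in case (ii), $|E_N|\leq CN$. (B) (minimal terrace length) $C\leq\lambda_N\leq C'$. (C) (system size) $CN\leq w_N\leq C'N$. In particular, $\lambda_N=O(1)$ and the system is in the non-bunching regime.
   Context: For real $-1<m<n$ (not necessarily integers) the pair potential is, for $x\neq 0$, $V(x)=-\frac1m|x|^{-m}+\frac1n|x|^{-n}$ if $m\neq0,n\neq 0$; $V(x)=\log|x|+\frac1n|x|^{-n}$ if $m=0<n$; $V(x)=-\frac1m|x|^{-m}-\log|x|$ if $m<n=0$. For $0\le\alpha\le1$ and a step configuration $Y_N=(y_1,\dots,y_N)$ with $y_1<\cdots<y_N$, the energy is $E[Y_N]=\sum_{1\le i<j\le N,\ j-i\le\lfloor N^\alpha\rfloor}V(y_j-y_i)$. The minimum energy is $E_N:=\min_{y_1<\cdots<y_N}E[Y_N]$; a minimizer is a configuration $X_N=(x_1,\dots,x_N)$, $x_1<\cdots<x_N$, with $E[X_N]=E_N$. For a configuration $X_N$: the minimal terrace length is $\lambda_N:=\min_{1\le i\le N-1}(x_{i+1}-x_i)$ and the system size is $w_N:=x_N-x_1$. A sequence of configurations $\{X_N\}$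 is a non-bunching sequence if $\liminf_{N\to\infty}w_N/N>0$. The system with parameters $m,n,\alpha$ is in the non-bunching regime if every sequence of energy minimizers is a non-bunching sequence. *)

(* Defs.v *)
From mathcomp Require Import all_boot all_order all_algebra.
From mathcomp Require Import all_classical all_reals all_analysis.
Set Implicit Arguments.
Unset Strict Implicit.
Unset Printing Implicit Defensive.
Import Order.TTheory GRing.Theory Num.Theory.
Import numFieldNormedType.Exports.
Local Open Scope classical_set_scope.
Local Open Scope ring_scope.

(* Only the values at x != 0 are meaningful, and only the parameters
   -1 < m < n are intended; in particular m and n are never both zero. *)
Definition potential (R : realType) (m n x : R) : R :=
  if m == 0 then ln `|x| + n^-1 * `|x| `^ (- n)
  else if n == 0 then - m^-1 * `|x| `^ (- m) - ln `|x|
  else - m^-1 * `|x| `^ (- m) + n^-1 * `|x| `^ (- n).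

(* The point y_k of a configuration is the value at the ordinal k - 1. *)
Definition configuration (R : realType) (N : nat) (y : 'I_N -> R) : Prop :=
  forall i j : 'I_N, (i < j)%N -> y i < y j.

Definition energy (R : realType) (m n alpha : R) (N : nat) (y : 'I_N -> R) : R :=
  \sum_(i < N) \sum_(j < N | (i < j)%N &&
      ((j - i)%N%:Z <= Num.floor (N%:R `^ alpha : R)))
    potential m n (y j - y i).

Definition is_minimizer (R : realType) (m n alpha : R) (N : nat)
    (x : 'I_N -> R) : Prop :=
  configuration x /\
  forall y : 'I_N -> R, configuration y ->
    energy m n alpha x <= energy m n alpha y.

(* By [min_energyE] the infimum is a minimum as soon as a minimizer exists. *)
Definition min_energy (R : realType) (m n alpha : R) (N : nat) : R :=
  inf [set energy m n alpha y | y in [set y : 'I_N -> R | configuration y]].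

Lemma min_energyE (R : realType) (m n alpha : R) (N : nat) (x : 'I_N -> R) :
  is_minimizer m n alpha x -> min_energy m n alpha N = energy m n alpha x.
Proof.
move=> [cx minx]; apply/eqP; rewrite eq_le; apply/andP; split.
  apply: ge_inf; last by exists x.
  by exists (energy m n alpha x) => _ [y cy <-]; exact: minx.
apply: lb_le_inf; first by exists (energy m n alpha x), x.
by move=> _ [y cy <-]; exact: minx.
Qed.

(* The k.+1 gaps x_(i+1) - x_i of a configuration of k.+2 points. *)
Definition gap (R : realType) (k : nat) (x : 'I_k.+2 -> R) (i : 'I_k.+1) : R :=
  x (lift ord0 i) - x (widen_ord (leqnSn k.+1) i).

(* The minimum of the gaps; it is set to 0 when there is no gap (N < 2). *)
Definition min_terrace (R : realType) (N : nat) : ('I_N -> R) -> R :=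
  match N return ('I_N -> R) -> R with
  | k.+2 => fun x => \big[Num.min/gap x ord0]_(i < k.+1) gap x i
  | _ => fun=> 0
  end.

Definition system_size (R : realType) (N : nat) : ('I_N -> R) -> R :=
  match N return ('I_N -> R) -> R with
  | k.+1 => fun x => x ord_max - x ord0
  | 0 => fun=> 0
  end.

Definition non_bunching (R : realType) (X : forall N : nat, 'I_N -> R) : Prop :=
  (0 < limn_einf (fun N : nat => (system_size (X N) / N%:R)%:E))%E.

Definition non_bunching_regime (R : realType) (m n alpha : R) : Prop :=
  forall X : forall N : nat, 'I_N -> R,
    (forall N, is_minimizer m n alpha (X N)) -> non_bunching X.

(* Main.v *)
Require Import Defs.
From mathcomp Require Import all_boot all_order all_algebra.
From mathcomp Require Import all_classical all_reals all_analysis.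
From mathcomp Require Import ring lra zify.
Import Order.TTheory GRing.Theory Num.Theory.
Import numFieldNormedType.Exports.
Local Open Scope classical_set_scope.
Local Open Scope ring_scope.
Set Implicit Arguments.
Unset Strict Implicit.
Unset Printing Implicit Defensive.

(** The potential is the difference of the antiderivatives of [x `^ (- m - 1)]
    and [x `^ (- n - 1)] ([potentialE]); it decreases on (0, 1] and increases
    on [1, +oo). Everything is obtained by translating rigidly the part of a
    minimizer on the right of one gap, which changes the distances of exactly
    the pairs that straddle this gap.

    No gap of a minimizer exceeds 1 ([minimizer_gap_le1]): all the pairs
    straddling a longer gap are in the region where the potential increases, so
    shortening the gap to 1 lowers all their energies.

    The gaps are bounded below, uniformly in [N]. For nearest-neighbour
    interactions a shorter gap can be lengthened to 1 for the same reason
    ([minimizer_gap_nearest]). For [1 < m] the smallest gap [g] is doubled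
    ([minimizer_smallest_gap]): the attraction lost is at most a constant times
    [g * g `^ (- m - 1)], because about [k] pairs of index distance [k]
    straddle the gap, each losing at most [g * (k * g) `^ (- m - 1)], and the
    series of [k ^ (- m)] converges; the repulsion gained is of order
    [g * g `^ (- n - 1)]. Minimality and [m < n] prevent [g] from being small.

    These two bounds contain the claims on the smallest terrace and on the
    system size, hence non-bunching. The lower bound on the gaps and the
    convergence of the series also bound the energy from below
    ([energy_ge]); the integer lattice as a competitor bounds it from above
    ([lattice_energy_le]). *)

(** * The pair potential *)

(** The antiderivative of [x `^ (- p - 1)] on the half-line [0 < x], for every
    real exponent [p]; the logarithm is what makes [p = 0] fit the pattern. *)
Definition pow_primitive (R : realType) (p x : R) : R :=
  if p == 0 then ln x else - p^-1 * x `^ (- p).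

(** The three formulas for the potential collapse into one difference of
    antiderivatives, so no later argument has to distinguish vanishing
    exponents; in particular the derivative is
    [x `^ (- m - 1) - x `^ (- n - 1)] in all cases. *)
Lemma potentialE (R : realType) (m n x : R) : m < n -> 0 < x ->
  potential m n x = pow_primitive m x - pow_primitive n x.
Proof.
move=> mn x0; rewrite /potential /pow_primitive (gtr0_norm x0).
have [m0|m0] := eqVneq m 0.
  have -> : (n == 0) = false by apply/eqP => n0; move: mn; rewrite m0 n0 ltxx.
  by rewrite mulNr opprK.
by have [//|n0] := eqVneq n 0; rewrite !mulNr opprK.
Qed.

Lemma is_derive_pow_primitive (R : realType) (p x : R) : 0 < x ->
  is_derive x 1 (pow_primitive p) (x `^ (- p - 1)).
Proof.
move=> x0; rewrite /pow_primitive; have [->|p0] := eqVneq p 0.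
  by rewrite oppr0 sub0r powR_inv1 ?(ltW x0)//; exact: is_derive1_ln.
have -> : x `^ (- p - 1) = (- p^-1) *: (- p * x `^ (- p - 1)).
  by rewrite /GRing.scale/= mulrA mulrNN mulVf// mul1r.
have D := is_derive1_powR (- p) x0.
exact: is_deriveZ.
Qed.

Lemma pow_primitive_MVT (R : realType) (p a b : R) : 0 < a -> a < b ->
  exists2 c, a < c < b &
    pow_primitive p b - pow_primitive p a = c `^ (- p - 1) * (b - a).
Proof.
move=> a0 ab.
have [||c] := @MVT R (pow_primitive p) (fun c => c `^ (- p - 1)) a b ab.
- move=> x; rewrite in_itv/= => /andP[ax _].
  by apply: is_derive_pow_primitive; exact: lt_trans ax.
- apply: derivable_within_continuous => x; rewrite in_itv/= => /andP[ax _].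
  have x0 : 0 < x by exact: lt_le_trans ax.
  by have D := is_derive_pow_primitive p x0; exact: ex_derive.
by rewrite in_itv/= => cab ->; exists c.
Qed.

Lemma ler_powR_npos (R : realType) (r a b : R) : r <= 0 -> 0 < a -> a <= b ->
  b `^ r <= a `^ r.
Proof.
move=> r0 a0 ab; have b0 : 0 < b by exact: lt_le_trans ab.
have -> : r = - - r by rewrite opprK.
rewrite [X in X <= _]powRN [X in _ <= X]powRN lef_pV2 ?posrE ?powR_gt0//.
by apply: ge0_ler_powR; rewrite ?nnegrE ?oppr_ge0 ?(ltW a0) ?(ltW b0).
Qed.

(** Finite-difference form of the derivative: estimates on finite displacements
    replace the first-order stationarity conditions at a minimizer. *)
Lemma pow_primitive_increment (R : realType) (p a b : R) :
  -1 < p -> 0 < a -> a <= b ->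
  (b - a) * b `^ (- p - 1) <= pow_primitive p b - pow_primitive p a
    <= (b - a) * a `^ (- p - 1).
Proof.
move=> p1 a0; rewrite le_eqVlt => /predU1P[<-|ab]; first by rewrite !subrr !mul0r lexx.
have [c /andP[ac cb] ->] := pow_primitive_MVT p a0 ab.
rewrite mulrC !(mulrC (b - a)) !ler_pM2r ?subr_gt0//.
by apply/andP; split; apply: ler_powR_npos; lra.
Qed.

(** The derivative is factored so that its sign, that of [c - 1], is visible:
    the well of the potential is at distance 1. *)
Lemma potential_MVT (R : realType) (m n a b : R) : m < n -> 0 < a -> a < b ->
  exists2 c, a < c < b & potential m n b - potential m n a =
    c `^ (- n - 1) * (c `^ (n - m) - 1) * (b - a).
Proof.
move=> mn a0 ab; have b0 : 0 < b by exact: lt_trans ab.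
pose F := pow_primitive m \- pow_primitive n.
have [||c] := @MVT R F (fun c => c `^ (- m - 1) - c `^ (- n - 1)) a b ab.
- move=> x; rewrite in_itv/= => /andP[ax _].
  have x0 : 0 < x by exact: lt_trans ax.
  have D1 := is_derive_pow_primitive m x0.
  have D2 := is_derive_pow_primitive n x0.
  exact: is_deriveB.
- apply: derivable_within_continuous => x; rewrite in_itv/= => /andP[ax _].
  have x0 : 0 < x by exact: lt_le_trans ax.
  have D1 := is_derive_pow_primitive m x0.
  have D2 := is_derive_pow_primitive n x0.
  by apply: derivableB; exact: ex_derive.
rewrite in_itv/= => cab; rewrite /F/= !potentialE// => ->.
exists c => //; congr (_ * _); rewrite mulrBr mulr1 -powRD.
  by congr (_ `^ _ - _); ring.
by rewrite (gt_eqF (lt_trans a0 (andP cab).1)) implybT.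
Qed.

Lemma potential_increasing (R : realType) (m n a b : R) : m < n ->
  1 <= a -> a < b -> potential m n a < potential m n b.
Proof.
move=> mn a1 ab; have a0 : 0 < a by lra.
have [c /andP[ac cb] E] := potential_MVT mn a0 ab.
rewrite -subr_gt0 E !mulr_gt0 ?subr_gt0 ?powR_gt0 //; first by lra.
have <- : 1 `^ (n - m) = 1 :> R by rewrite powR1.
  apply: gt0_ltr_powR; rewrite ?nnegrE; lra.
Qed.

Lemma potential_decreasing (R : realType) (m n a b : R) : m < n ->
  0 < a -> a < b -> b <= 1 -> potential m n b < potential m n a.
Proof.
move=> mn a0 ab b1; have [c /andP[ac cb] E] := potential_MVT mn a0 ab.
rewrite -subr_lt0 E pmulr_llt0 ?subr_gt0// pmulr_rlt0 ?subr_lt0 ?powR_gt0//; last by lra.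
have <- : 1 `^ (n - m) = 1 :> R by rewrite powR1.
  apply: gt0_ltr_powR; rewrite ?nnegrE; lra.
Qed.


(** * Sums of negative powers *)

(** Comparison of the sum with the integral: beyond its first term, each summand
    is at most the increment of the antiderivative over the preceding unit
    interval, and these increments telescope. *)
Lemma sum_negative_powers_le (R : realType) (p : R) (a b : nat) :
  0 < p -> (0 < a)%N ->
  \sum_(a <= k < b) k%:R `^ (- p - 1) <= (1 + p^-1) * a%:R `^ (- p).
Proof.
move=> p0 a0; have aR : 0 < a%:R :> R by rewrite ltr0n.
have [ba|/subnKC <-] := leqP b a.
  by rewrite big_geq// mulr_ge0 ?powR_ge0// addr_ge0 ?invr_ge0// ltW.
have telescope d : \sum_(a <= k < a.+1 + d) k%:R `^ (- p - 1) <=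
    a%:R `^ (- p - 1) + (pow_primitive p (a + d)%:R - pow_primitive p a%:R).
  elim: d => [|d IH]; first by rewrite !addn0 big_nat1 subrr addr0.
  rewrite addnS big_nat_recr/=; last by rewrite addSn ltnW// ltnS leq_addr.
  have ad : 0 < (a + d)%:R :> R by rewrite ltr0n addn_gt0 a0.
  have le_ad : (a + d)%:R <= (a.+1 + d)%:R :> R by rewrite ler_nat addSn.
  have /andP[+ _] := pow_primitive_increment (lt_trans (ltrN10 R) p0) ad le_ad.
  by rewrite -natrB ?addSn// subSn// subnn mul1r !addnS; move: IH; lra.
apply: le_trans (telescope _) _.
rewrite mulrDl mul1r lerD// ?ler_powR ?ler1n//; first lra.
rewrite /pow_primitive gt_eqF// !mulNr opprK gerDr oppr_le0.
by rewrite mulr_ge0 ?invr_ge0 ?powR_ge0// ltW.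
Qed.

(** The interaction of the point [i] with everything to the right of [a]; the
    exponent improves by one, which makes a second summation over [i] possible
    in the next lemma. *)
Lemma sum_right_points_le (R : realType) (r : R) (N i a : nat) :
  0 < r -> (i <= a)%N ->
  \sum_(j < N | (a < j)%N) (j - i)%:R `^ (- r - 1)
    <= (1 + r^-1) * (a.+1 - i)%:R `^ (- r).
Proof.
move=> r0 ia.
have -> : \sum_(j < N | (a < j)%N) (j - i)%:R `^ (- r - 1) =
    \sum_(a.+1 - i <= k < N - i) k%:R `^ (- r - 1).
  rewrite -(big_geq_mkord a.+1 N xpredT (fun j => (j - i)%:R `^ (- r - 1))).
  rewrite -{1}(@subnK i a.+1) ?(leqW ia)// big_addn.
  by apply: eq_bigr => k _; rewrite addnK.
by apply: sum_negative_powers_le => //; rewrite subn_gt0 ltnS.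
Qed.

(** The number of pairs at distance [k] that straddle a given gap grows like
    [k], so the sum behaves like that of [k ^ (- m)]: this is where [1 < m] is
    needed, uniformly in the interaction range. *)
Lemma sum_crossing_pairs_le (R : realType) (m : R) (N a : nat) :
  1 < m -> (a < N)%N ->
  \sum_(i < N | (i <= a)%N) \sum_(j < N | (a < j)%N) (j - i)%:R `^ (- m - 1)
    <= (1 + m^-1) * (1 + (m - 1)^-1).
Proof.
move=> m1 aN.
apply: (@le_trans _ _ (\sum_(i < N | (i <= a)%N)
    (1 + m^-1) * (a.+1 - i)%:R `^ (- m))).
  by apply: ler_sum => i ia; apply: sum_right_points_le => //; lra.
rewrite -mulr_sumr ler_wpM2l ?addr_ge0 ?invr_ge0//; first lra.
rewrite (_ : \sum_(_ < N | _) _ = \sum_(1 <= k < a.+2) k%:R `^ (- (m - 1) - 1)).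
  apply: le_trans (@sum_negative_powers_le R (m - 1) 1 _ _ _) _ => //; first lra.
  by rewrite powR1 mulr1.
rewrite -(big_ord_widen N (fun i => (a.+1 - i)%:R `^ (- m)) aN).
rewrite -(big_mkord xpredT (fun i => (a.+1 - i)%:R `^ (- m))) big_nat_rev/=.
rewrite big_add1/= !big_mkord; apply: eq_bigr => i _.
by rewrite add0n subKn//; congr (_ `^ _); ring.
Qed.

(** * Opening or closing one gap of a minimizer *)

Definition interacts (R : realType) (alpha : R) (N : nat) (i j : 'I_N) : bool :=
  (i < j)%N && ((j - i)%N%:Z <= Num.floor (N%:R `^ alpha : R)).

Lemma energyE (R : realType) (m n alpha : R) (N : nat) (y : 'I_N -> R) :
  energy m n alpha y =
    \sum_(i < N) \sum_(j < N | interacts alpha i j) potential m n (y j - y i).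
Proof. by []. Qed.

Lemma interacts_next (R : realType) (alpha : R) (N : nat) (a b : 'I_N) :
  0 <= alpha -> b = a.+1 :> nat -> interacts alpha a b.
Proof.
move=> alpha0 ab; rewrite /interacts ab ltnSn subSnn/= floor_ge_int.
have N1 : 1 <= N%:R :> R by rewrite ler1n (leq_ltn_trans _ (ltn_ord a)).
by rewrite -[leLHS](powRr0 N%:R) ler_powR.
Qed.

Lemma interacts0 (R : realType) (N : nat) (i j : 'I_N) :
  interacts (0 : R) i j = (j == i.+1 :> nat).
Proof.
apply/idP/eqP => [|ij]; last exact: interacts_next.
by rewrite /interacts powRr0 floor1 => /andP[]; lia.
Qed.

Lemma configurationP (R : realType) (N : nat) (y : 'I_N -> R) :
  configuration y <->
  forall a b : 'I_N, b = a.+1 :> nat -> y a < y b.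
Proof.
split=> [cy a b ab|next i j]; first by apply: cy; rewrite ab.
have [d] := ubnP (j - i)%N; elim: d => // d IH in j *.
rewrite ltnS => jid ij.
have [ij1|ij1] := eqVneq (nat_of_ord j) i.+1; first exact: next.
have j'N : (j.-1 < N)%N by rewrite (leq_ltn_trans (leq_pred j)).
apply: (@lt_trans _ _ (y (Ordinal j'N))); first by apply: IH => /=; lia.
by apply: next => /=; lia.
Qed.

(** Applied to the opposite of a configuration and to [- C], it also turns upper
    bounds on the gaps into upper bounds on all distances. *)
Lemma gaps_ge_increments (R : realType) (C : R) (N : nat) (y : 'I_N -> R) :
  (forall a b : 'I_N, b = a.+1 :> nat -> C <= y b - y a) ->
  forall i j : 'I_N, (i <= j)%N -> (j - i)%:R * C <= y j - y i.
Proof.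
move=> next i j.
have [d] := ubnP (j - i)%N; elim: d => // d IH in j *.
rewrite ltnS => jid ij.
have [ij1|ij1] := eqVneq (nat_of_ord j) i.
  by rewrite ij1 subnn mul0r (_ : j = i) ?subrr//; exact: val_inj.
have j'N : (j.-1 < N)%N by rewrite (leq_ltn_trans (leq_pred j)).
have H1 : (j.-1 - i)%:R * C <= y (Ordinal j'N) - y i.
    by apply: (IH (Ordinal j'N)) => /=; move/eqP: ij1; lia.
have H2 : C <= y j - y (Ordinal j'N) by apply: next => /=; lia.
have -> : (j - i = (j.-1 - i).+1)%N by move/eqP: ij1; lia.
by rewrite -natr1; lra.
Qed.

(** Variational inequality at a minimizer, with the change of the energy of the
    adjacent pair [(a, b)] accounted for apart in [c]. All bounds on gaps come
    from competitors for which [c] is negative. *)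
Lemma minimizer_pair_change (R : realType) (m n alpha : R) (N : nat)
    (x y : 'I_N -> R) (a b : 'I_N) (G : 'I_N -> 'I_N -> R) (c : R) :
  0 <= alpha -> is_minimizer m n alpha x -> configuration y ->
  b = a.+1 :> nat ->
  (forall i j, interacts alpha i j ->
    potential m n (y j - y i) - potential m n (x j - x i)
      <= G i j + (if (i == a) && (j == b) then c else 0)) ->
  0 <= (\sum_(i < N) \sum_(j < N | interacts alpha i j) G i j) + c.
Proof.
move=> alpha0 [cx minx] cy ab change.
have /(_ y cy) := minx; rewrite -subr_ge0 !energyE => le0.
apply: le_trans le0 _; rewrite -sumrB.
under eq_bigr do rewrite -sumrB.
have sumc : \sum_(i < N) \sum_(j < N | interacts alpha i j)
    (if (i == a) && (j == b) then c else 0) = c.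
  rewrite (bigD1 a)//= (bigD1 b) ?interacts_next//= !eqxx/=.
  rewrite [X in c + X]big1 => [|j /andP[_ /negbTE ->]//].
  rewrite addr0 big1 ?addr0// => i /negbTE ia.
  by apply: big1 => j _; rewrite ia.
rewrite -[in leRHS]sumc -big_split/=; apply: ler_sum => i _.
by rewrite -big_split/=; apply: ler_sum => j ij; exact: change.
Qed.

(** Translating rigidly all the points on the right of [a] affects only the
    pairs that straddle the gap after [a]. Negative values of [s] close the
    gap. *)
Definition open_gap (R : realType) (N : nat) (x : 'I_N -> R) (a : nat) (s : R)
  : 'I_N -> R := fun j => if (a < j)%N then x j + s else x j.

Lemma open_gap_configuration (R : realType) (N : nat) (x : 'I_N -> R)
    (a b : 'I_N) (s : R) :
  configuration x -> b = a.+1 :> nat -> 0 < x b - x a + s ->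
  configuration (open_gap x a s).
Proof.
move=> cx ab gs; apply/configurationP => i j ij; rewrite /open_gap.
have xij : x i < x j by apply: cx; rewrite ij.
case: ltnP => ai; case: ltnP => aj; [lra | lia | | lra].
have -> : i = a by apply: val_inj => /=; lia.
have -> : j = b by apply: val_inj => /=; lia.
lra.
Qed.

(** All pairs straddling a gap longer than 1 are more than 1 apart, where the
    potential increases. Closing that gap to length 1 keeps them at distance at
    least 1, so every straddling interaction decreases. *)
Lemma minimizer_gap_le1 (R : realType) (m n alpha : R) (N : nat)
    (x : 'I_N -> R) (a b : 'I_N) :
  m < n -> 0 <= alpha -> is_minimizer m n alpha x ->
  b = a.+1 :> nat -> x b - x a <= 1.
Proof.
move=> mn alpha0 minx ab; rewrite leNgt; apply/negP => g1.
have [cx _] := minx; set g := x b - x a in g1.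
have cy : configuration (open_gap x a (1 - g)).
  by apply: open_gap_configuration ab _ => //; rewrite /g; lra.
pose c := potential m n 1 - potential m n g.
have := minimizer_pair_change (G := fun _ _ => 0) (c := c) alpha0 minx cy ab.
rewrite big1 => [|i _]; last exact: big1.
rewrite add0r /c subr_ge0 leNgt potential_increasing// => H; suff: ~~ true by [].
apply: H => i j; rewrite /interacts /open_gap => /andP[ij _]; rewrite add0r.
case: (boolP ((i == a) && (j == b))) => [/andP[/eqP -> /eqP ->]|iajb].
  rewrite ab ltnSn ltnn; have -> // : x b + (1 - g) - x a = 1.
  by rewrite /g; ring.
have le x0 : x0 = x j - x i -> potential m n x0 - potential m n (x j - x i) <= 0.
  by move=> ->; rewrite subrr.
have mono (p q : 'I_N) : (p <= q)%N -> x p <= x q.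
  by rewrite leq_eqVlt => /predU1P[/val_inj ->//|/cx/ltW].
case: ltnP => aj; case: ltnP => ai; [apply: le; ring | | lia | exact: le].
have xia := mono _ _ ai; have xbj : x b <= x j by apply: mono; rewrite ab.
rewrite subr_le0 ltW// potential_increasing//; rewrite /g in g1 *; lra.
Qed.

(** With nearest neighbours only, a single pair straddles a given gap, so the
    gaps can be moved independently to the bottom of the well. *)
Lemma minimizer_gap_nearest (R : realType) (m n : R) (N : nat)
    (x : 'I_N -> R) (a b : 'I_N) :
  m < n -> is_minimizer m n 0 x -> b = a.+1 :> nat -> x b - x a = 1.
Proof.
move=> mn minx ab; apply/eqP; rewrite eq_le (minimizer_gap_le1 mn _ minx ab)//=.
rewrite leNgt; apply/negP => g1.
have [cx _] := minx; set g := x b - x a in g1.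
have g0 : 0 < g by rewrite subr_gt0; apply: cx; rewrite ab.
have cy : configuration (open_gap x a (1 - g)).
  by apply: open_gap_configuration ab _ => //; rewrite /g; lra.
pose c := potential m n 1 - potential m n g.
have := minimizer_pair_change (G := fun _ _ => 0) (c := c) (lexx 0) minx cy ab.
rewrite big1 => [|i _]; last exact: big1.
rewrite add0r /c subr_ge0 leNgt potential_decreasing// => H; suff: ~~ true by [].
apply: H => i j; rewrite interacts0 => /eqP ij; rewrite /open_gap add0r.
case: (boolP ((i == a) && (j == b))) => [/andP[/eqP -> /eqP ->]|iajb].
  rewrite ab ltnSn ltnn; have -> // : x b + (1 - g) - x a = 1.
  by rewrite /g; ring.
have le x0 : x0 = x j - x i -> potential m n x0 - potential m n (x j - x i) <= 0.
  by move=> ->; rewrite subrr.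
case: ltnP => aj; case: ltnP => ai; [apply: le; ring | | lia | exact: le].
case/negP: iajb; apply/andP; split; apply/eqP/val_inj => /=; lia.
Qed.

(** * A lower bound on the gaps *)

(** The bound of [sum_crossing_pairs_le]. *)
Definition crossing_constant (R : realType) (m : R) : R :=
  (1 + m^-1) * (1 + (m - 1)^-1).

(** The value of [g] at which the repulsion gained by doubling a gap [g],
    [(2 g) `^ (- n - 1)], balances the attraction lost across it, at most
    [crossing_constant m * g `^ (- m - 1)], after division of both by [g]. *)
Definition gap_bound (R : realType) (m n : R) : R :=
  (2 `^ (n + 1) * crossing_constant m) `^ (- (n - m)^-1).

Lemma crossing_constant_gt0 (R : realType) (m : R) :
  1 < m -> 0 < crossing_constant m.
Proof. by move=> m1; rewrite mulr_gt0 ?addr_gt0 ?invr_gt0//; lra. Qed.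

Lemma gap_bound_gt0 (R : realType) (m n : R) : 1 < m -> 0 < gap_bound m n.
Proof.
by move=> m1; rewrite powR_gt0// mulr_gt0 ?powR_gt0 ?crossing_constant_gt0.
Qed.

(** Doubling the smallest gap [g] must not lower the energy. Two points [k]
    places apart are at distance at least [k * g], so the attraction lost
    is at most [g * g `^ (- m - 1)] times a sum that is bounded independently of [N] and
    of the range, while the two neighbours of the gap alone gain a repulsion
    of order [g * g `^ (- n - 1)]. As [m < n], this excludes small [g]. *)
Lemma minimizer_smallest_gap (R : realType) (m n alpha : R) (N : nat)
    (x : 'I_N -> R) (a b : 'I_N) :
  1 < m -> m < n -> 0 <= alpha -> is_minimizer m n alpha x ->
  b = a.+1 :> nat ->
  (forall c d : 'I_N, d = c.+1 :> nat -> x b - x a <= x d - x c) ->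
  gap_bound m n <= x b - x a.
Proof.
move=> m1 mn alpha0 minx ab smallest.
have N1m : -1 < m by lra.
have N1n : -1 < n by lra.
have [cx _] := minx; set g := x b - x a in smallest *.
have g0 : 0 < g by rewrite subr_gt0; apply: cx; rewrite ab.
have spread := gaps_ge_increments smallest.
have cy : configuration (open_gap x a g).
  by apply: open_gap_configuration ab _ => //; rewrite -/g; lra.
pose G (i j : 'I_N) := if (i <= a)%N && (a < j)%N
  then g * (g `^ (- m - 1) * (j - i)%:R `^ (- m - 1)) else 0.
pose c := - (g * (g + g) `^ (- n - 1)).
have change i j : interacts alpha i j ->
    potential m n (open_gap x a g j - open_gap x a g i)
      - potential m n (x j - x i)
    <= G i j + (if (i == a) && (j == b) then c else 0).
  rewrite /interacts /open_gap /G => /andP[ij _].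
  have [ai|ia] := ltnP a i.
    rewrite (ltn_trans ai ij) /=.
    rewrite (_ : x j + g - _ = x j - x i) ?subrr; last by ring.
    case: ifP => [/andP[/eqP ia _]|_]; last by rewrite addr0.
    by rewrite ia ltnn in ai.
  have [aj|ja] := ltnP a j; last first.
    rewrite subrr add0r; case: ifP => // /andP[_ /eqP jb].
    by rewrite jb ab ltnn in ja.
  have k0 : 0 < (j - i)%:R :> R by rewrite ltr0n subn_gt0.
  have dk : (j - i)%:R * g <= x j - x i by apply: spread; exact: ltnW.
  have kg0 : 0 < (j - i)%:R * g by rewrite mulr_gt0.
  have d0 : 0 < x j - x i by exact: lt_le_trans dk.
  rewrite (_ : x j + g - x i = x j - x i + g); last by ring.
  have dg : x j - x i <= x j - x i + g by rewrite lerDl ltW.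
  rewrite !potentialE//; last by rewrite addr_gt0.
  have /andP[_] := pow_primitive_increment N1m d0 dg.
  have /andP[+ _] := pow_primitive_increment N1n d0 dg.
  rewrite (_ : _ + g - (x j - x i) = g); last by ring.
  (* Homogeneity separates the scale [g] from the index distance [j - i]. *)
  have : g * (x j - x i) `^ (- m - 1) <=
      g * (g `^ (- m - 1) * (j - i)%:R `^ (- m - 1)).
    rewrite ler_pM2l// mulrC -powRM ?(ltW g0) ?(ltW k0)//.
    by apply: ler_powR_npos => //; lra.
  have : 0 <= g * (x j - x i + g) `^ (- n - 1) by rewrite mulr_ge0 ?powR_ge0// ltW.
  case: ifP => [/andP[/eqP -> /eqP ->]|_]; rewrite /c -/g/=; lra.
have := minimizer_pair_change alpha0 minx cy ab change.
have sumG : \sum_(i < N) \sum_(j < N | interacts alpha i j) G i j <=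
    g * (g `^ (- m - 1) * crossing_constant m).
  have G0 i j : 0 <= G i j.
    by rewrite /G; case: ifP; rewrite ?mulr_ge0 ?powR_ge0// ltW.
  apply: (@le_trans _ _ (\sum_(i < N) \sum_(j < N) G i j)).
    apply: ler_sum => i _; rewrite [leRHS](bigID (interacts alpha i))/=.
    by rewrite lerDl sumr_ge0.
  have -> : \sum_(i < N) \sum_(j < N) G i j = g * (g `^ (- m - 1) *
      \sum_(i < N | (i <= a)%N) \sum_(j < N | (a < j)%N)
         (j - i)%:R `^ (- m - 1)).
    rewrite !mulr_sumr [RHS]big_mkcond; apply: eq_bigr => i _; rewrite /G.
    case: (leqP i a) => ia /=; last by rewrite big1.
    by rewrite !mulr_sumr [RHS]big_mkcond.
  rewrite ler_pM2l// ler_pM2l ?powR_gt0//.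
  exact: sum_crossing_pairs_le.
move=> /le_trans/(_ (lerD sumG (lexx c))).
rewrite subr_ge0 ler_pM2l// (_ : g + g = 2 * g); last by ring.
rewrite powRM ?(ltW g0)// => balance.
(* Multiplying by [2 `^ (n + 1) * g `^ (m + 1)] isolates the power of [g]. *)
have {}balance : g `^ (m - n) <= 2 `^ (n + 1) * crossing_constant m.
  rewrite -(ler_pM2l (powR_gt0 (- m - 1) g0)) -powRD; last first.
    by rewrite (gt_eqF g0) implybT.
  rewrite (_ : - m - 1 + (m - n) = - n - 1); last by ring.
  rewrite -(ler_pM2l (powR_gt0 (- n - 1) (ltr0n R 2))).
  apply: le_trans balance _; rewrite le_eqVlt; apply/orP; left; apply/eqP.
  rewrite [RHS]mulrCA; congr (_ * _); rewrite [RHS]mulrA -powRD.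
    by rewrite (_ : - n - 1 + (n + 1) = 0) ?powRr0 ?mul1r//; ring.
  by rewrite pnatr_eq0 implybT.
rewrite /gap_bound; apply: le_trans (ler_powR_npos _ _ balance) _.
- by rewrite oppr_le0 invr_ge0; lra.
- exact: powR_gt0.
rewrite -powRrM (_ : (m - n) * - (n - m)^-1 = 1) ?powRr1 ?(ltW g0)//.
by field; lra.
Qed.

(** * Energy bounds *)

(** Dropping the repulsion, each point interacts with the points on its right
    with an energy bounded below by a convergent series; the stability of the
    system follows from the lower bound on the gaps alone. *)
Lemma energy_ge (R : realType) (m n alpha l : R) (N : nat) (x : 'I_N -> R) :
  1 < m -> m < n -> 0 < l ->
  (forall a b : 'I_N, b = a.+1 :> nat -> l <= x b - x a) ->
  - (m^-1 * l `^ (- m) * (1 + (m - 1)^-1)) * N%:R <= energy m n alpha x.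
Proof.
move=> m1 mn l0 gaps; have spread := gaps_ge_increments gaps.
rewrite mulr_natr -[in leLHS](card_ord N) -sumr_const energyE.
apply: ler_sum => i _.
have m0 : 0 < m by lra.
have K0 : 0 <= m^-1 * l `^ (- m) by rewrite mulr_ge0 ?invr_ge0 ?powR_ge0// ltW.
apply: (@le_trans _ _ (\sum_(j < N | interacts alpha i j)
    - (m^-1 * l `^ (- m) * (j - i)%:R `^ (- m)))).
  rewrite sumrN lerN2 -mulr_sumr ler_wpM2l//.
  apply: (@le_trans _ _ (\sum_(j < N | (i < j)%N) (j - i)%:R `^ (- m))).
    rewrite [leRHS](bigID (interacts alpha i))/=.
    apply: ler_wpDr; first by apply: sumr_ge0 => j _; exact: powR_ge0.
    rewrite le_eqVlt; apply/orP; left; apply/eqP; apply: eq_bigl => j.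
    by rewrite /interacts andbA andbb.
  have := @sum_right_points_le R (m - 1) N i i _ (leqnn i).
  rewrite subSnn powR1 mulr1 (_ : - (m - 1) - 1 = - m); last by ring.
  by apply; lra.
apply: ler_sum => j; rewrite /interacts => /andP[ij _].
have k0 : 0 < (j - i)%:R :> R by rewrite ltr0n subn_gt0.
have dk : (j - i)%:R * l <= x j - x i by apply: spread; exact: ltnW.
have d0 : 0 < x j - x i by apply: lt_le_trans dk; rewrite mulr_gt0.
rewrite potentialE// /pow_primitive !gt_eqF//; last by lra.
rewrite !mulNr opprK -[leLHS]addr0 lerD//; last first.
  by rewrite mulr_ge0 ?invr_ge0 ?powR_ge0//; lra.
rewrite lerN2 -mulrA ler_pM2l ?invr_gt0// mulrC -powRM ?(ltW l0) ?(ltW k0)//.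
by rewrite [X in _ <= X `^ _]mulrC mulrC; apply: ler_powR_npos => //;
  rewrite ?mulr_gt0//; lra.
Qed.

Lemma lattice_configuration (R : realType) (N : nat) :
  configuration (fun i : 'I_N => (i : nat)%:R : R).
Proof. by move=> i j ij; rewrite ltr_nat. Qed.

Lemma potential_lt0 (R : realType) (m n x : R) :
  0 < m -> m < n -> 1 <= x -> potential m n x < 0.
Proof.
move=> m0 mn x1; have x0 : 0 < x by lra.
rewrite potentialE// /pow_primitive !gt_eqF//; last by lra.
rewrite !mulNr opprK addrC subr_lt0.
have nm : x `^ (- n) <= x `^ (- m) by rewrite ler_powR//; lra.
apply: (@lt_le_trans _ _ (m^-1 * x `^ (- n))).
  by rewrite ltr_pM2r ?powR_gt0// ltf_pV2 ?posrE//; lra.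
by rewrite ler_pM2l ?invr_gt0.
Qed.

(** On the integer lattice no pair has positive energy, so the [k.+1] adjacent
    pairs already give a bound. *)
Lemma lattice_energy_le (R : realType) (m n alpha : R) (k : nat) :
  0 < m -> m < n -> 0 <= alpha ->
  energy m n alpha (fun i : 'I_k.+2 => (i : nat)%:R : R)
    <= potential m n 1 *+ k.+1.
Proof.
move=> m0 mn alpha0; rewrite energyE.
have neg (i j : 'I_k.+2) : interacts alpha i j ->
    potential m n ((j : nat)%:R - (i : nat)%:R) <= 0.
  rewrite /interacts => /andP[ij _].
  by rewrite -natrB 1?ltnW// ltW// potential_lt0// ler1n subn_gt0.
rewrite big_ord_recr/= -[leRHS]addr0.
apply: lerD; last by apply: sumr_le0 => j; exact: neg.
rewrite -[in leRHS](card_ord k.+1) -sumr_const; apply: ler_sum => i _.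
rewrite (bigD1 (lift ord0 i))/=; last exact: interacts_next.
rewrite -[leRHS]addr0 lerD//; last by apply: sumr_le0 => j /andP[+ _]; exact: neg.
by rewrite -natrB ?lift0/= ?subSnn.
Qed.

Lemma minimizer_energy_nearest (R : realType) (m n : R) (N : nat)
    (x : 'I_N -> R) :
  m < n -> is_minimizer m n 0 x ->
  `|energy m n 0 x| <= `|potential m n 1| * N%:R.
Proof.
move=> mn minx; rewrite energyE; apply: le_trans (ler_norm_sum _ _ _) _.
rewrite mulr_natr -[in leRHS](card_ord N) -sumr_const; apply: ler_sum => i _.
have [Ni|iN] := leqP N i.+1.
  rewrite big1 ?normr0// => j; rewrite interacts0 => /eqP ij.
  by have := ltn_ord j; rewrite ij ltnNge Ni.
rewrite (big_pred1 (Ordinal iN)) => [|j]; last by rewrite interacts0.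
by rewrite (minimizer_gap_nearest mn minx).
Qed.

(** * Scaling laws *)

Lemma minimizer_gap_ge (R : realType) (m n alpha : R) :
  (1 < m /\ m < n /\ 0 < alpha /\ alpha <= 1) \/
  (-1 < m /\ m < n /\ alpha = 0) ->
  exists2 l : R, 0 < l & forall (N : nat) (x : 'I_N -> R),
    is_minimizer m n alpha x ->
    forall a b : 'I_N, b = a.+1 :> nat -> l <= x b - x a.
Proof.
case=> [[m1 [mn [alpha0 _]]]|[m1 [mn ->]]]; last first.
  by exists 1 => // N x minx a b ab; rewrite (minimizer_gap_nearest mn minx ab).
exists (gap_bound m n); first exact: gap_bound_gt0.
move=> N x minx a b ab; pose next (p : 'I_N * 'I_N) := p.2 == p.1.+1 :> nat.
have ab' : next (a, b) by apply/eqP.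
case: (arg_minP (fun p : 'I_N * 'I_N => x p.2 - x p.1) ab').
move=> [c d] /eqP/= cd least.
apply: le_trans (least (a, b) ab').
apply: minimizer_smallest_gap m1 mn (ltW alpha0) minx cd _ => e f ef.
by apply: (least (e, f)); apply/eqP.
Qed.

Lemma min_terrace_ge (R : realType) (N : nat) (x : 'I_N -> R) (l : R) :
  (1 < N)%N -> (forall a b : 'I_N, b = a.+1 :> nat -> l <= x b - x a) ->
  l <= min_terrace x.
Proof.
case: N x => [|[|k]]// x _ gaps.
have gap_ge (i : 'I_k.+1) : l <= gap x i by exact: gaps.
by apply: le_bigmin.
Qed.

Lemma min_terrace_le (R : realType) (N : nat) (x : 'I_N -> R) (u : R) :
  (1 < N)%N -> (forall a b : 'I_N, b = a.+1 :> nat -> x b - x a <= u) ->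
  min_terrace x <= u.
Proof.
case: N x => [|[|k]]// x _ gaps.
by apply: le_trans (bigmin_le_id _ _ _ _) _; exact: gaps.
Qed.

Lemma system_size_ge (R : realType) (N : nat) (x : 'I_N -> R) (l : R) :
  (forall a b : 'I_N, b = a.+1 :> nat -> l <= x b - x a) ->
  N.-1%:R * l <= system_size x.
Proof.
case: N x => [|k] x gaps; first by rewrite mul0r.
by have := gaps_ge_increments gaps (leq0n ord_max : (ord0 <= _)%N); rewrite subn0.
Qed.

Lemma system_size_le (R : realType) (N : nat) (x : 'I_N -> R) (u : R) :
  (forall a b : 'I_N, b = a.+1 :> nat -> x b - x a <= u) ->
  system_size x <= N.-1%:R * u.
Proof.
move=> gaps; have := @system_size_ge R N (\- x) (- u).
rewrite mulrN lerNl; have -> : - system_size (\- x) = system_size x.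
  by case: N x {gaps} => [|k] x /=; rewrite ?oppr0//=; ring.
by apply => a b ab; have := gaps _ _ ab; rewrite /=; lra.
Qed.

Lemma linear_size_non_bunching (R : realType) (c : R) (N0 : nat)
    (X : forall N, 'I_N -> R) : 0 < c ->
  (forall N, (N0 < N)%N -> c * N%:R <= system_size (@X N)) -> non_bunching X.
Proof.
move=> c0 size_ge; rewrite /non_bunching limn_einf_lim.
apply: (@lt_le_trans _ _ c%:E); first by rewrite lte_fin.
apply: lime_ge; first exact: is_cvg_einfs.
exists N0.+1 => // N /= N0N; apply: le_ereal_inf_tmp => _ [M /= NM <-].
have N0M := leq_trans N0N NM.
by rewrite lee_fin ler_pdivlMr ?size_ge// ltr0n (leq_ltn_trans _ N0M).
Qed.

Lemma eventually_bounded_bigO1 (R : realType) (u : nat -> R) (C : R) (N0 : nat) :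
  0 < C -> (forall N, (N0 < N)%N -> `|u N| <= C) -> u =O_\oo (fun=> (1 : R)).
Proof.
move=> C0 bounded; apply/eqO_exP; exists C => //.
by exists N0.+1 => // N /= N0N; rewrite normr1 mulr1 bounded.
Qed.

(** The factor 2 absorbs the difference between the number of points and the
    number of gaps. *)
Lemma min_energy_le_linear (R : realType) (m n alpha : R) (N : nat) (x : 'I_N -> R) :
  0 < m -> m < n -> 0 <= alpha -> (1 < N)%N -> is_minimizer m n alpha x ->
  min_energy m n alpha N <= - (- potential m n 1 / 2) * N%:R.
Proof.
move=> m0 mn alpha0; case: N x => [|[|k]]// x _ minx.
rewrite (min_energyE minx).
apply: le_trans (minx.2 _ (@lattice_configuration R _)) _.
apply: le_trans (lattice_energy_le k m0 mn alpha0) _.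
have V1 := potential_lt0 m0 mn (lexx 1).
have k0 : 0 <= k%:R :> R by exact: ler0n.
rewrite -[leLHS]mulr_natr.
have k2E : k.+2%:R = k%:R + 2 :> R by rewrite -natrD addn2.
have k1E : k.+1%:R = k%:R + 1 :> R by rewrite natr1.
rewrite k2E k1E.
have Vk : potential m n 1 * k%:R <= 0 by rewrite nmulr_rle0.
lra.
Qed.

Theorem theorem2 (R : realType) (m n alpha : R)
    (hyp : (1 < m /\ m < n /\ 0 < alpha /\ alpha <= 1) \/
           (-1 < m /\ m < n /\ alpha = 0)) :
  (exists (N0 : nat) (CA CA' CB CB' CC CC' : R),
    [/\ (0 < N0)%N,
        0 < CA /\ 0 < CA',
        0 < CB /\ 0 < CB',
        0 < CC /\ 0 < CC' &
      forall (N : nat), (N0 < N)%N ->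
      forall (X : 'I_N -> R), is_minimizer m n alpha X ->
      [/\ (1 < m /\ m < n /\ 0 < alpha /\ alpha <= 1 ->
             - CA * N%:R <= min_energy m n alpha N /\
             min_energy m n alpha N <= - CA' * N%:R),
          (-1 < m /\ m < n /\ alpha = 0 ->
             `|min_energy m n alpha N| <= CA * N%:R),
          CB <= min_terrace X /\ min_terrace X <= CB' &
          CC * N%:R <= system_size X /\ system_size X <= CC' * N%:R]])
  /\ (forall X : forall N : nat, 'I_N -> R,
        (forall N : nat, is_minimizer m n alpha (X N)) ->
        (fun N : nat => min_terrace (X N)) =O_\oo (fun=> (1 : R)))
  /\ non_bunching_regime m n alpha.
Proof.
have [l l0 gaps_ge] := minimizer_gap_ge hyp.
have mn : m < n by case: hyp => [[_ []]|[_ []]].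
have alpha0 : 0 <= alpha by case: hyp => [[_ [_ [/ltW]]]|[_ [_ ->]]].
have gaps_le N (X : 'I_N -> R) : is_minimizer m n alpha X ->
    forall a b : 'I_N, b = a.+1 :> nat -> X b - X a <= 1.
  by move=> minX a b; exact: minimizer_gap_le1 minX.
have terrace N (X : 'I_N -> R) : (1 < N)%N -> is_minimizer m n alpha X ->
    l <= min_terrace X /\ min_terrace X <= 1.
  move=> N1 minX; split; first exact: min_terrace_ge (gaps_ge _ _ minX).
  exact: min_terrace_le (gaps_le _ _ minX).
have size N (X : 'I_N -> R) : (1 < N)%N -> is_minimizer m n alpha X ->
    l / 2 * N%:R <= system_size X /\ system_size X <= 1 * N%:R.
  move=> N1 minX.
  have := system_size_ge (gaps_ge _ _ minX).
  have := system_size_le (gaps_le _ _ minX).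
  rewrite -subn1 natrB ?(ltnW N1)//.
  have N2 : 2 <= N%:R :> R by rewrite ler_nat.
  by split; nra.
split; last split.
- pose V1 := potential m n 1.
  (* For nearest neighbours [m] may be negative or zero, but the constants must
     be positive there too: hence the absolute value and the conditional. *)
  pose E := `|m^-1 * l `^ (- m) * (1 + (m - 1)^-1)|.
  exists 1%N, (E + `|V1| + 1), (if 0 < m then - V1 / 2 else 1), l, 1, (l / 2), 1.
  have E0 : 0 <= E by exact: normr_ge0.
  have V10 : 0 <= `|V1| by exact: normr_ge0.
  split=> //.
  + split; first lra.
    by case: ifP => // m0; have := potential_lt0 m0 mn (lexx 1); rewrite -/V1; lra.
  + by split => //; lra.
  move=> N N1 X minX.
  have N0 : 0 <= N%:R :> R by exact: ler0n.
  split; [move=> [m1 _]|move=> [_ [_ a0]]|exact: terrace|exact: size].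
  + have m0 : 0 < m by lra.
    split; last by rewrite m0; exact: min_energy_le_linear minX.
    rewrite (min_energyE minX).
    apply: le_trans (energy_ge alpha m1 mn l0 (gaps_ge _ _ minX)).
    rewrite ler_wpM2r// lerN2; apply: le_trans (ler_norm _) _; rewrite -/E; lra.
  + rewrite (min_energyE minX); rewrite a0 in minX *.
    apply: le_trans (minimizer_energy_nearest mn minX) _.
    by rewrite ler_wpM2r// -/V1; lra.
- move=> X minX; apply: (@eventually_bounded_bigO1 _ _ 1 1) => // N N1.
  have [lX X1] := terrace N (X N) N1 (minX N).
  by rewrite ger0_norm// (le_trans (ltW l0)).
- move=> X minX; apply: (@linear_size_non_bunching _ (l / 2) 1); first lra.
  by move=> N N1; have [] := size N (X N) N1 (minX N).
Qed.
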